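(* Let $p$ be a prime and let $A, B$ be countably based abelian pro-$p$ groups. If $t(B)$ is of unbounded exponent, then $A$ is topologically isomorphic to a closed subgroup of $\overline{t(B)}$.
   Context: A profinite group is countably based if its identity has a countable neighbourhood basis. $t(B)$ is the subgroup of torsion elements of $B$, and $\overline{t(B)}$ is its topological closure in $B$. ''Of unbounded exponent'' means not annihilated by any positive integer. *)

(* Defs.v *)
From HB Require Import structures.
From mathcomp Require Import all_boot all_order all_algebra.
From mathcomp Require Import all_classical all_reals all_analysis.

Set Implicit Arguments.
Unset Strict Implicit.
Unset Printing Implicit Defensive.

Import Order.TTheory GRing.Theory Num.Theory.

Local Open Scope classical_set_scope.
Local Open Scope ring_scope.

(** Abelian topological groups are written additively, as topologicalZmodType:
    the group operations are continuous, and no separation axiom is built in. *)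

Definition is_subgroup (G : zmodType) (H : set G) : Prop :=
  H 0 /\ forall x y, H x -> H y -> H (x - y).

(** The set of cosets of H has exactly n elements. *)
Definition has_index (G : zmodType) (H : set G) (n : nat) : Prop :=
  (range (fun x : G => [set x + h | h in H]) #= `I_n)%card.

Definition profinite (G : topologicalZmodType) : Prop :=
  [/\ compact [set: G], hausdorff_space G & totally_disconnected [set: G]].

(** The groups being abelian, every open subgroup is normal. *)
Definition pro_p (p : nat) (G : topologicalZmodType) : Prop :=
  profinite G /\
  forall U : set G, is_subgroup U -> open U ->
    exists k : nat, has_index U (p ^ k)%N.

Definition countably_based (G : topologicalZmodType) : Prop :=
  exists C : set_system G,
    [/\ countable C, C `<=` nbhs (0 : G) &
        forall U : set G, nbhs (0 : G) U -> exists2 V, C V & V `<=` U].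

Definition torsion (G : zmodType) : set G :=
  [set x | exists2 n : nat, (0 < n)%N & x *+ n = 0].
Arguments torsion : clear implicits.

Definition unbounded_exponent (G : zmodType) (H : set G) : Prop :=
  ~ exists2 n : nat, (0 < n)%N & forall x, H x -> x *+ n = 0.

(** K is meant to be closed (here it is a closure), so that being closed in K
    and being closed in G are the same for a subset H of K. *)
Definition closed_subgroup_of (G : topologicalZmodType) (K H : set G) : Prop :=
  [/\ is_subgroup H, H `<=` K & closed H].

(** A is isomorphic, as a topological group, to the subgroup H of G with the
    subspace topology: f is the isomorphism onto H; g restricts on H to its
    inverse, and its values outside H are irrelevant. *)
Definition top_isomorphic (A G : topologicalZmodType) (H : set G) : Prop :=
  exists (f : {additive A -> G}) (g : G -> A),
    [/\ continuous (f : A -> G), range f = H, cancel f g &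
        {within H, continuous g}].
Arguments top_isomorphic : clear implicits.

(* Main.v *)
(* Continuous characters A -> Z/p^k separate the points of A, and countably
   many phi_0, phi_1, ... suffice.  Since open subgroups of B have finite index,
   and t(B) has unbounded exponent, each of them contains torsion elements of
   every order p^k; so one can choose torsion elements b_n and open
   subgroups V_0 >= V_1 >= ... shrinking to 0 with b_n in V_n,
   <b_n> meeting V_(n+1) trivially, and b_n of the order needed to make
   phi_n a character with values in <b_n>.  Then
   a |-> \sum_n phi_n(a) converges, and it is injective: if n is least with
   phi_n(a) <> 0, then a sum equal to 0 would put phi_n(a) in V_(n+1). *)
Require Import Defs.
From HB Require Import structures.
From mathcomp Require Import all_boot all_order all_algebra.
From mathcomp Require Import all_classical all_reals all_analysis.
From mathcomp Require Import zify.

Set Implicit Arguments.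
Unset Strict Implicit.
Unset Printing Implicit Defensive.

Import Order.TTheory GRing.Theory Num.Theory.

Local Open Scope classical_set_scope.
Local Open Scope ring_scope.

(** * Zero-dimensionality of profinite spaces *)

(* In a compact Hausdorff space the intersection Q of the clopen sets around x
   is connected: if Q were split by two relatively open sets, normality and
   compactness would give a clopen set around x missing one of them. *)
Lemma totally_disconnected_zero_dimensional (T : topologicalType) :
  compact [set: T] -> hausdorff_space T -> totally_disconnected [set: T] ->
  zero_dimensional T.
Proof.
move=> cT hT tdT x y xy.
pose Q := [set z | forall D : set T, clopen D -> D x -> D z].
have Qx : Q x by move=> D _.
have clQ : closed Q.
  move=> z clz D cD Dx; apply: cD.2 => W /clz [w [Qw Ww]].
  by exists w; split => //; exact: Qw.
(* If every clopen set around [x] met the complement of [O], these traces would generate a proper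
   filter on a compact set; a cluster point would lie in [Q] but outside [O]. *)
have Qsub (O : set T) : open O -> Q `<=` O ->
    exists D : set T, [/\ clopen D, D x & D `<=` O].
  move=> oO QO; apply: contrapT => nD.
  pose F := filter_from [set D : set T | clopen D /\ D x] (fun D => D `&` ~` O).
  have PF : ProperFilter F.
    apply: filter_from_proper; last first.
      move=> D [cD Dx]; apply/set0P/eqP => D0; apply: nD; exists D; split => //.
      by move=> z Dz; apply: contrapT => nOz; have : set0 z by rewrite -D0.
    apply: filter_from_filter.
      by exists setT; split => //; exact: clopenT.
    move=> D D' [cD Dx] [cD' Dx']; exists (D `&` D').
      by split => //; exact: clopenI.
    by move=> z [[Dz D'z] nOz].
  have cO : compact (~` O).
    by apply: (subclosed_compact _ cT) => //; exact: open_closedC.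
  have FO : F (~` O).
    by exists setT => [|z []//]; split => //; exact: clopenT.
  have [z [nOz clz]] := cO F PF FO.
  apply: nOz; apply: QO => D cD Dx; apply: cD.2.
  by move=> W Wz; apply: clz => //; exists D => // w [].
have conQ : connected Q.
  move=> E [s Es] [W oW EW] [C clC EC].
  have clS : closed E by rewrite EC; exact: closedI.
  have clS' : closed (Q `\` E).
    have -> : Q `\` E = Q `&` ~` W.
      rewrite EW; apply/seteqP; split => z [Qz nz]; split => //.
        by move=> Wz; apply: nz.
      by move=> [].
    by apply: closedI => //; exact: open_closedC.
  have [U SU US] : filter_from (set_nbhs E) closure (~` (Q `\` E)).
    apply: (compact_normal hT cT clS); apply/set_nbhsP.
    exists (~` (Q `\` E)); split => //; first exact: closed_openC.
    by move=> z Ez [].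
  have [V [oV SV VU]] : exists V, [/\ open V, E `<=` V & V `<=` U].
    by apply/set_nbhsP.
  have [||D [cD Dx DO]] := Qsub (V `|` ~` closure U).
  - by apply: openU => //; apply: closed_openC; exact: closed_closure.
  - move=> z Qz; have [Ez|nEz] := pselect (E z); first by left; exact: SV.
    by right => /US; apply.
  (* [D] avoids the part of [closure U] outside [V], so its trace on [V] is both open and closed.
     Whether or not [x] is in [V], a clopen piece of [D] around [x] then loses a point of [Q]. *)
  have DE : D `&` V = D `&` closure U.
    apply/seteqP; split => z [Dz Vz]; split => //.
      by apply: subset_closure; exact: VU.
    by have [//|] := DO z Dz.
  have cDV : clopen (D `&` V).
    split; first by apply: openI => //; exact: cD.1.
    by rewrite DE; apply: closedI; [exact: cD.2|exact: closed_closure].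
  have SQ : E `<=` Q by rewrite EW => z [].
  apply/seteqP; split => // z Qz; apply: contrapT => nEz.
  have [Vx|nVx] := pselect (V x).
    have [_ Vz] := Qz _ cDV (conj Dx Vx).
    by apply: (US z) => //; apply: subset_closure; exact: VU.
  have cDV' : clopen (D `\` V).
    rewrite setDE; split; last by apply: closedI; [exact: cD.2|exact: open_closedC].
    have -> : D `&` ~` V = D `&` ~` (closure U).
      apply/seteqP; split => w [Dw nw]; split => //.
        by move=> cw; have [_ /nw] : (D `&` V) w by rewrite DE.
      by move=> Vw; have [_ /nw] : (D `&` closure U) w by rewrite -DE.
    apply: openI; first exact: cD.1.
    by apply: closed_openC; exact: closed_closure.
  by have [_] := SQ s Es _ cDV' (conj Dx nVx); apply; exact: SV.
have : Q `<=` [set x].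
  by rewrite -(tdT x) // => z Qz; exists Q => //; split.
move=> Qsubx.
have : ~ Q y by move=> /Qsubx yx; move: xy; rewrite yx eqxx.
by move=> /existsNP [D /not_implyP [cD /not_implyP [Dx nDy]]]; exists D.
Qed.

(** * Elementary closure properties of subgroups *)

Section subgroups.
Variable G : zmodType.
Implicit Types (H : set G) (x y : G).

Lemma subgroup0 H : is_subgroup H -> H 0. Proof. by case. Qed.

Lemma subgroupB H x y : is_subgroup H -> H x -> H y -> H (x - y).
Proof. by case=> _; apply. Qed.

Lemma subgroupN H x : is_subgroup H -> H x -> H (- x).
Proof. by move=> sH Hx; rewrite -sub0r; apply: subgroupB => //; case: sH. Qed.

Lemma subgroupD H x y : is_subgroup H -> H x -> H y -> H (x + y).
Proof.
by move=> sH Hx Hy; rewrite -[y]opprK; apply: subgroupB => //; exact: subgroupN.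
Qed.

Lemma subgroupMn H x n : is_subgroup H -> H x -> H (x *+ n).
Proof.
move=> sH Hx; elim: n => [|n IH]; first by rewrite mulr0n; exact: subgroup0.
by rewrite mulrS; exact: subgroupD.
Qed.

Lemma subgroupMz H x (z : int) : is_subgroup H -> H x -> H (x *~ z).
Proof.
move=> sH Hx; case: z => n; first exact: subgroupMn.
by rewrite NegzE mulrNz; apply: subgroupN => //; exact: subgroupMn.
Qed.

Lemma subgroup_trans H x y : is_subgroup H -> H (x - y) -> H y -> H x.
Proof. by move=> sH Hxy Hy; rewrite -(subrK y x); exact: subgroupD. Qed.

Lemma subgroup_set0 : is_subgroup [set 0 : G].
Proof. by split=> // x y -> -> /=; rewrite subr0. Qed.

Lemma subgroupI H H' : is_subgroup H -> is_subgroup H' -> is_subgroup (H `&` H').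
Proof.
move=> sH sH'; split; first by split; exact: subgroup0.
by move=> x y [Hx H'x] [Hy H'y]; split; exact: subgroupB.
Qed.

Lemma subgroup_sum H (I : Type) (r : seq I) (P : pred I) (F : I -> G) :
  is_subgroup H -> (forall i, P i -> H (F i)) -> H (\sum_(i <- r | P i) F i).
Proof.
move=> sH HF; apply: (big_ind H) => //; first exact: subgroup0.
by move=> x y; exact: subgroupD.
Qed.

End subgroups.

(** * Open subgroups of topological groups *)

Section topological_groups.
Variable G : topologicalZmodType.
Implicit Types (U K : set G) (x : G).

Lemma addl_continuous x : continuous (fun y : G => x + y).
Proof.
move=> y; apply: (@continuous_comp _ _ _ (fun y => (x, y))
  (fun z : G * G => z.1 + z.2)).
  by apply: cvg_pair => //=; exact: cvg_cst.
exact: add_continuous.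
Qed.

Lemma nbhs_addl U x : nbhs x U <-> nbhs (0 : G) [set y | U (x + y)].
Proof.
split=> [Ux|U0].
  by apply: (addl_continuous (x := x) (x0 := 0)); rewrite addr0.
have : nbhs x ((fun y => - x + y) @^-1` [set y | U (x + y)]).
  by apply: addl_continuous; rewrite addNr.
by apply: filterS => y /=; rewrite addrA addrN add0r.
Qed.

Lemma subgroup_nbhs_open U : is_subgroup U -> nbhs 0 U -> open U.
Proof.
move=> sU nU; rewrite openE => x Ux; apply/nbhs_addl.
by apply: filterS nU => y Uy; exact: subgroupD.
Qed.

Lemma open_subgroup_nbhs U : is_subgroup U -> open U -> nbhs 0 U.
Proof. by move=> sU oU; apply: open_nbhs_nbhs; split => //; exact: subgroup0. Qed.

Lemma open_subgroup_closed U : is_subgroup U -> open U -> closed U.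
Proof.
move=> sU oU x clx.
have /clx [y [Uy /= Uyx]] : nbhs x [set y | U (y - x)].
  apply/nbhs_addl; apply: filterS (open_subgroup_nbhs sU oU) => y Uy /=.
  by rewrite addrC addKr.
by rewrite -(subKr y x); exact: subgroupB.
Qed.

Lemma coset_closed U x : is_subgroup U -> open U -> closed [set y | U (y - x)].
Proof.
move=> sU oU.
have -> : [set y | U (y - x)] = (fun y => - x + y) @^-1` U.
  by apply/seteqP; split => y /=; rewrite addrC.
apply: (continuous_closedP _).1; first exact: addl_continuous.
exact: open_subgroup_closed.
Qed.

(* The stabiliser of a clopen neighbourhood K of 0 is an open subgroup
   contained in K; openness is the tube lemma. *)
Lemma profinite_open_subgroup U : profinite G -> nbhs 0 U ->
  exists V, [/\ is_subgroup V, open V & V `<=` U].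
Proof.
move=> [cG hG tdG] nU.
have [K [K0 [oK clK]] KU] := zero_dimensional_cvg hG
  (totally_disconnected_zero_dimensional cG hG tdG) cG nU.
pose V := [set x | forall k, K (x + k) <-> K k].
have sV : is_subgroup V.
  split=> [k|x y Vx Vy k]; first by rewrite add0r.
  by have := Vx (- y + k); have := Vy (- y + k); rewrite !addrA subrr add0r; tauto.
exists V; split => //; last first.
  by move=> x /(_ 0); rewrite addr0 => Vx; apply: KU; exact/Vx.
apply: subgroup_nbhs_open => //.
pose S := [set x | forall k, K k -> K (x + k)].
have nS : nbhs 0 S.
  have cK : compact K by exact: subclosed_compact clK cG _.
  have /compact_near_coveringP/(_ G (nbhs 0) (fun x k => K (x + k))) := cK.
  apply=> k Kk; near_simpl.
  have nk : nbhs (k + 0) K by rewrite addr0; apply: open_nbhs_nbhs; split.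
  have : nbhs (k, 0 : G) [set z : G * G | K (z.2 + z.1)].
    apply: (@filterS _ (nbhs (k, 0 : G)) _ [set z | K (z.1 + z.2)]).
      by move=> [a b] /=; rewrite addrC.
    exact: (@add_continuous G (k, 0) K nk).
  exact.
(* [S] only gives one inclusion; translating by [- x] as well gives the converse. *)
have nSN : nbhs 0 [set x | S (- x)].
  by apply: (@opp_continuous G 0); rewrite oppr0.
apply: filterS (filterI nS nSN) => x [Sx SNx] k; split=> [Kxk|]; last exact: Sx.
by rewrite -(addKr x k); exact: SNx.
Qed.

End topological_groups.

(** * Finite index and orders modulo a subgroup *)

Lemma coset_representatives (G : zmodType) (U : set G) n :
  is_subgroup U -> has_index U n ->
  exists r : 'I_n -> G, (forall x, exists i, U (x - r i)) /\
                        (forall i j, U (r i - r j) -> i = j).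
Proof.
move=> sU /card_set_bijP [f [fI finj fsurj]].
pose c x := [set x + h | h in U].
have cE x y : U (x - y) -> c x = c y.
  move=> Uxy; apply/seteqP; split => _ [h Uh <-].
    by exists (x - y + h); [exact: subgroupD | rewrite addrA addrCA subrr addr0].
  exists (y - x + h); last by rewrite addrA addrCA subrr addr0.
  by apply: subgroupD => //; rewrite -opprB; exact: subgroupN.
have /choice [r rP] : forall i : 'I_n, exists x, f (c x) = i.
  by move=> i; have [_ [x _ <-] fx] := fsurj i (ltn_ord i); exists x.
exists r; split=> [x|i j /cE rij]; last by apply: val_inj; rewrite /= -!rP rij.
have fx : (f (c x) < n)%N by apply: fI; exists x.
exists (Ordinal fx).
have : c x = c (r (Ordinal fx)).
  apply: finj; rewrite ?rP //; apply/mem_set; first by exists x.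
  by exists (r (Ordinal fx)).
move: (r _) => y cx; have [h Uh <-] : c y x.
  by rewrite -cx; exists 0; rewrite ?addr0 //; exact: subgroup0.
by rewrite addrC addKr.
Qed.

(** Translation by [x] permutes the cosets, by [s] on representatives. Summing [r i + x - r (s i)],
    which lies in [U], over all [i] cancels the representatives and leaves [x *+ n]. *)
Lemma index_mulrn (G : zmodType) (U : set G) n x :
  is_subgroup U -> has_index U n -> U (x *+ n).
Proof.
move=> sU /(coset_representatives sU) [r [rU rinj]].
have /choice [s sP] : forall i, exists j, U (r i + x - r j) by move=> i; exact: rU.
have s_inj : injective s.
  move=> i j sij; apply: rinj.
  have := subgroupB sU (sP i) (sP j); rewrite sij.
  by rewrite opprB addrA subrK opprD addrACA subrr addr0.
have -> : x *+ n = \sum_i (r i + x - r (s i)).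
  rewrite sumrB big_split /= sumr_const card_ord.
  by rewrite [X in _ = X + _ - _](reindex_inj s_inj) /= addrAC subrr add0r.
exact: subgroup_sum.
Qed.

(* On the line through x, membership in S is divisibility by a power of p. *)
Lemma prime_power_order (G : zmodType) (S : set G) p k x :
  prime p -> is_subgroup S -> S (x *+ p ^ k) ->
  exists i, [/\ (i <= k)%N, S (x *+ p ^ i) &
                forall z : int, S (x *~ z) -> (p ^ i %| `|z|)%N].
Proof.
move=> pp sS Sk.
have Sgcd (m n : nat) : S (x *+ m) -> S (x *+ n) -> S (x *+ gcdn m n).
  have [-> _|m0] := posnP m; first by rewrite gcd0n.
  case: (egcdnP n m0) => a b e _ Sm Sn.
  have := subgroupB sS (subgroupMn a sS Sm) (subgroupMn b sS Sn).
  rewrite -!mulrnA ![(_ * a)%N]mulnC ![(_ * b)%N]mulnC e mulrnDr addrAC subrr.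
  by rewrite add0r.
have Sabs (z : int) : S (x *~ z) -> S (x *+ `|z|%N).
  case: z => n //; rewrite NegzE mulrNz => /(subgroupN sS); rewrite opprK.
  by rewrite abszN absz_nat.
have ex : exists i, `[< S (x *+ p ^ i) >] by exists k; apply/asboolP.
case: (ex_minnP ex) => i /asboolP Si imin; exists i; split => //.
  by apply: imin; apply/asboolP.
move=> z /Sabs Sz.
(* The gcd is a power [p ^ j] that also carries [x] into [S], so minimality of [i] forces
   [j = i]. *)
have /(dvdn_pfactor _ _ pp) [j ji e] := dvdn_gcdr `|z| (p ^ i).
suff ij : i = j by rewrite {1}ij -e dvdn_gcdl.
apply/eqP; rewrite eqn_leq ji andbT; apply: imin; apply/asboolP.
by rewrite -e; exact: Sgcd.
Qed.

(** * Extension of characters with values in a cyclic p-group *)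

Lemma mem_pair (A B : Type) (F : set (A * B)) v x y :
  F v -> v.1 = x -> v.2 = y -> F (x, y).
Proof. by case: v => ? ? + /= <- <-. Qed.

Section character_extension.
Variables (A B : zmodType) (p e : nat) (U : set A) (b : B).
Hypotheses (p_prime : prime p) (sU : is_subgroup U).
Hypothesis Upe : forall x, U (x *+ p ^ e).
Hypothesis b_order : forall z : int, (b *~ z == 0) = (p ^ e %| `|z|)%N.

(* Graphs of homomorphisms to <b>, defined on a subgroup containing U and
   vanishing on U. *)
Definition partial_character (F : set (A * B)) : Prop :=
  [/\ is_subgroup F, forall y, F (0, y) -> y = 0,
      forall x y, F (x, y) -> exists z : int, y = b *~ z &
      forall u, U u -> F (u, 0)].

(** For a subgroup [F], this is the subgroup generated by [F] and [(x, d)]: the candidate graph of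
    the extension sending [x] to [d]. *)
Definition adjoin (F : set (A * B)) (x : A) (d : B) : set (A * B) :=
  [set v | exists n : int, F (v.1 - x *~ n, v.2 - d *~ n)].

Definition domain (F : set (A * B)) : set A := [set x | exists y, F (x, y)].

Lemma domain_subgroup F : partial_character F -> is_subgroup (domain F).
Proof.
move=> [sF _ _ _]; split; first by exists 0; exact: (subgroup0 sF).
by move=> x x' [y Fy] [y' Fy']; exists (y - y'); exact: (subgroupB sF Fy Fy').
Qed.

Lemma domain_order F x : partial_character F ->
  exists i, [/\ (i <= e)%N, domain F (x *+ p ^ i) &
                forall z : int, domain F (x *~ z) -> (p ^ i %| `|z|)%N].
Proof.
move=> cF; apply: prime_power_order => //; first exact: domain_subgroup.
by exists 0; have [_ _ _] := cF; apply; exact: Upe.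
Qed.

Lemma adjoin_sub F x d : F `<=` adjoin F x d.
Proof. by move=> [u v] Fuv; exists 0; rewrite !mulr0z !subr0. Qed.

Lemma adjoinP F x d : is_subgroup F -> adjoin F x d (x, d).
Proof.
by move=> sF; exists 1; rewrite !mulr1z !subrr; exact: (subgroup0 sF).
Qed.

(** The extension is single-valued because the multiples of [x] already in the domain are multiples
    of [x *+ p ^ i], where the old and new values agree. *)
Lemma adjoin_partial_character F x i (t : int) : partial_character F ->
  (forall z : int, domain F (x *~ z) -> (p ^ i %| `|z|)%N) ->
  F (x *+ p ^ i, b *~ t *+ p ^ i) -> partial_character (adjoin F x (b *~ t)).
Proof.
move=> cF xi Fx; have [sF F0 Fb FU] := cF; set d := b *~ t in Fx *.
split.
- split; first by apply: adjoin_sub; exact: (subgroup0 sF).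
  move=> [u v] [u' v'] [n Fn] [n' Fn']; exists (n - n') => /=.
  by apply: (mem_pair (subgroupB sF Fn Fn')) => /=;
    rewrite mulrzBr opprD addrACA -opprD.
- move=> y [n /=]; rewrite sub0r => Fn.
  have dn : domain F (x *~ n).
    rewrite -[x *~ n]opprK; apply: subgroupN; first exact: domain_subgroup.
    by exists (y - d *~ n).
  have [m nm] : exists m : int, n = (p ^ i)%N%:Z * m.
    by have /dvdzP [m ->] : ((p ^ i)%N%:Z %| n)%Z;
      [exact: xi | exists m; rewrite mulrC].
  apply: F0; apply: (mem_pair (subgroupD sF Fn (subgroupMz m sF Fx))) => /=.
    by rewrite (raddfMz fst) /= nm mulrzA addNr.
  by rewrite (raddfMz snd) /= nm mulrzA subrK.
- move=> u v [n /= /Fb [z vz]]; exists (z + t * n).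
  by rewrite mulrzDr mulrzA -/d -vz subrK.
- by move=> u /FU; exact: adjoin_sub.
Qed.

(** A cyclic group of order [p ^ e] is injective among groups killed by [p ^ e]: the value at
    [x *+ p ^ i] is killed by [p ^ (e - i)], hence divisible by [p ^ i] in the group generated by
    [b], and a quotient serves as value at [x]. *)
Lemma partial_character_extend F x : partial_character F ->
  exists2 F', partial_character F' & F `<=` F' /\ domain F' x.
Proof.
move=> cF; have [i [ie [y Fy] xi]] := domain_order x cF.
have [sF F0 Fb FU] := cF.
have [z yz] := Fb _ _ Fy.
have [t zt] : exists t : int, z = t * (p ^ i)%N.
  apply/dvdzP; change (p ^ i %| `|z|)%N.
  have pi0 : (0 < p ^ (e - i))%N by rewrite expn_gt0 prime_gt0.
  rewrite -(dvdn_pmul2l pi0) -expnD subnK // -[(p ^ (e - i))%N]absz_nat.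
  rewrite -abszM -b_order.
  rewrite mulrC mulrzA -yz; apply/eqP; apply: F0.
  have FU0 := FU _ (Upe x); have Fpy := subgroupMn (p ^ (e - i)) sF Fy.
  apply: (mem_pair (subgroupB sF Fpy FU0)) => /=.
    by rewrite (raddfMn fst) /= -mulrnA -expnD subnKC // subrr.
  by rewrite (raddfMn snd) /= subr0 pmulrn.
exists (adjoin F x (b *~ t)); last first.
  by split; [exact: adjoin_sub | exists (b *~ t); exact: adjoinP].
apply: adjoin_partial_character cF xi _.
by rewrite [b *~ t *+ _]pmulrn -mulrzA -zt -yz.
Qed.

(** Adjoining finitely many points is enough: with [U] of finite index, coset representatives
    together with [U] exhaust [A]. *)
Lemma partial_character_total F (s : seq A) : partial_character F ->
  exists2 F', partial_character F' & F `<=` F' /\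
    forall x, x \in s -> domain F' x.
Proof.
elim: s F => [|x s IH] F cF; first by exists F => //; split.
have [F1 cF1 [FF1 F1x]] := partial_character_extend x cF.
have [F2 cF2 [F12 F2s]] := IH _ cF1; exists F2 => //; split.
  exact: subset_trans F12.
move=> x'; rewrite in_cons => /orP [/eqP ->|/F2s //].
by case: F1x => y /F12; exists y.
Qed.

(** Start from the zero character on [U]. If [x0] has order [p ^ i] modulo [U], then [i > 0], and
    [x0] may be sent to [b] times [p ^ (e - i)], which is nonzero of the same order; then extend to
    all representatives. *)
Lemma separating_character n x0 : has_index U n -> ~ U x0 ->
  exists f : A -> B, [/\ forall x y, f (x - y) = f x - f y,
    forall u, U u -> f u = 0, f x0 <> 0 & forall x, exists z : int, f x = b *~ z].
Proof.
move=> iU nUx0; pose F0 : set (A * B) := [set v | U v.1 /\ v.2 = 0].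
have cF0 : partial_character F0.
  split; last 1 first.
  - by move=> u Uu; split.
  - split; first by split => //; exact: subgroup0.
    move=> [u v] [u' v'] [/= Uu ->] [/= Uu' ->]; split => /=; last by rewrite subr0.
    exact: subgroupB.
  - by move=> y [].
  - by move=> x y [_ /= ->]; exists 0; rewrite mulr0z.
have [i [ie [y [Ui _]] xi]] := domain_order x0 cF0.
have i0 : (0 < i)%N.
  by rewrite lt0n; apply/eqP => i0; apply: nUx0; rewrite i0 expn0 in Ui.
have cF1 : partial_character (adjoin F0 x0 (b *~ (p ^ (e - i))%N)).
  apply: adjoin_partial_character cF0 xi _; split => //=.
  apply/eqP; rewrite pmulrn -mulrzA b_order abszM !absz_nat -expnD subnK //.
have [r [rU _]] := coset_representatives sU iU.
have [F [sF Ft Fb FU] [F1F Fr]] := partial_character_total (codom r) cF1.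
have Ftot x : domain F x.
  have [j Uj] := rU x; have [y' Fy'] := Fr _ (codom_f r j).
  exists y'.
  by apply: (mem_pair (subgroupD sF (FU _ Uj) Fy')) => /=; rewrite ?subrK ?add0r.
have Funiq x y1 y2 : F (x, y1) -> F (x, y2) -> y1 = y2.
  move=> F1 F2; apply/eqP; rewrite -subr_eq0; apply/eqP/Ft.
  by apply: (mem_pair (subgroupB sF F1 F2)) => //=; rewrite subrr.
have [f fP] := choice Ftot; exists f; split.
- move=> x x'; apply: (Funiq (x - x')) => //; exact: (subgroupB sF (fP x) (fP x')).
- by move=> u Uu; apply: (Funiq u) => //; exact: FU.
- have -> : f x0 = b *~ (p ^ (e - i))%N.
    by apply: (Funiq x0) => //; apply: F1F; apply: adjoinP; case: cF0.
  move/eqP; rewrite b_order absz_nat dvdn_Pexp2l ?prime_gt1 //.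
  by rewrite leqNgt ltn_subrL i0 (leq_trans i0 ie).
- by move=> x; exact: Fb (fP x).
Qed.

End character_extension.

(** * Countable bases of open subgroups, and separation by them *)

(** An open subgroup is chosen inside each member of the countable base, numbered by the injection
    [f]; numbers outside its image receive the whole group. *)
Lemma open_subgroup_basis (G : topologicalZmodType) :
  profinite G -> countably_based G ->
  exists U : nat -> set G, [/\ forall n, is_subgroup (U n), forall n, open (U n) &
    forall N, nbhs 0 N -> exists n, U n `<=` N].
Proof.
move=> pG [C [/countable_injP [f finj] Cn CB]].
have /choice [U UP] : forall n, exists V : set G, [/\ is_subgroup V, open V &
    forall W, C W -> f W = n -> V `<=` W].
  move=> n; have [[W [CW fW]]|nW] := pselect (exists W, C W /\ f W = n).
    have [V [sV oV VW]] := profinite_open_subgroup pG (Cn _ CW).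
    exists V; split => // W' CW' fW'.
    by have -> : W' = W by apply: finj; rewrite ?inE // fW fW'.
  exists setT; split; [by [] | exact: openT | move=> W CW fW].
  by case: nW; exists W.
exists U; split=> [n|n|N /CB [W CW WN]]; try by have [] := UP n.
by exists (f W); have [_ _ UW] := UP (f W); apply: subset_trans WN; exact: UW.
Qed.

Lemma profinite_separated (G : topologicalZmodType) (x : G) :
  profinite G -> (forall U, is_subgroup U -> open U -> U x) -> x = 0.
Proof.
move=> pG xU; have [_ hG _] := pG.
apply/esym/hG => N N' N0 N'x.
have [V [sV oV VN]] := profinite_open_subgroup pG N0.
by exists x; split; [apply: VN; exact: xU | exact: nbhs_singleton].
Qed.

(** * Torsion elements of prescribed order in small open subgroups *)

(** Serves both for the order of [b] itself, with [S] trivial, and for its order modulo an open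
    subgroup. *)
Lemma exact_prime_power_order (G : zmodType) (S : set G) p e b (z : int) :
  prime p -> is_subgroup S -> S (b *+ p ^ e.+1) -> ~ S (b *+ p ^ e) ->
  S (b *~ z) -> (p ^ e.+1 %| `|z|)%N.
Proof.
move=> pp sS Sb nSb; have [i [ie Si Sdvd]] := prime_power_order pp sS Sb.
suff -> : e.+1 = i by exact: Sdvd.
apply/eqP; rewrite eqn_leq ie andbT leqNgt; apply/negP; rewrite ltnS => ie'.
apply: nSb; rewrite -(subnKC ie') expnD mulrnA; exact: subgroupMn.
Qed.

Section torsion_sequence.
Variables (p : nat) (B : topologicalZmodType).
Hypotheses (p_prime : prime p) (B_pro_p : pro_p p B).

(** Write [n] as a power of [p] times [q] prime to [p]. Modulo an open subgroup, the multiple of [t]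
    by that power has order both a power of [p] and a divisor of [q], so it lies in every open
    subgroup. *)
Lemma pro_p_torsion_order (t : B) : torsion B t -> exists i, t *+ p ^ i = 0.
Proof.
move=> [n n0 tn]; have [q pq nq] := pfactor_coprime p_prime n0.
exists (logn p n); apply: (profinite_separated B_pro_p.1) => V sV oV.
have [r /(index_mulrn (t *+ p ^ logn p n) sV)] := B_pro_p.2 V sV oV.
move=> /(prime_power_order p_prime sV) [i [_ Vi /(_ q%:Z)]].
rewrite -pmulrn -mulrnA mulnC -nq tn => /(_ (subgroup0 sV)) /= iq.
suff i0 : i = 0%N by move: Vi; rewrite i0 expn0 mulr1n.
apply/eqP; apply: contraTT pq; rewrite -lt0n => ipos.
rewrite prime_coprime // negbK; apply: dvdn_trans iq.
by rewrite -{1}(expn1 p) dvdn_exp2l.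
Qed.

Hypothesis tB_unbounded : unbounded_exponent (torsion B).

(* [B : V] kills B modulo V, so V still has torsion of unbounded exponent. *)
Lemma torsion_in_open_subgroup (V : set B) e : is_subgroup V -> open V ->
  exists b, [/\ V b, b *+ p ^ e.+1 = 0 & b *+ p ^ e <> 0].
Proof.
move=> sV oV; have [m Vm] := B_pro_p.2 V sV oV.
have [t [tt nt]] : exists t, torsion B t /\ t *+ p ^ (m + e) <> 0.
  apply: contrapT => nt; apply: tB_unbounded; exists (p ^ (m + e))%N.
    by rewrite expn_gt0 prime_gt0.
  by move=> t tt; apply: contrapT => t0; apply: nt; exists t.
have ex : exists i, t *+ p ^ i == 0.
  by have [i /eqP ti] := pro_p_torsion_order tt; exists i.
case: (ex_minnP ex) => i /eqP ti imin.
have mei : (m + e < i)%N.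
  rewrite ltnNge; apply/negP => ile; apply: nt.
  by rewrite -(subnKC ile) expnD mulrnA ti mul0rn.
exists (t *+ p ^ (i - e.+1)); split.
(* The multiplier contains the factor [p ^ m], the index of [V], which forces the multiple into
   [V]. *)
- have -> : (i - e.+1 = m + (i - (m + e).+1))%N by lia.
  by rewrite expnD mulrnA; apply: subgroupMn => //; exact: index_mulrn.
- by rewrite -mulrnA -expnD subnK //; lia.
- rewrite -mulrnA -expnD => /eqP /imin; lia.
Qed.

(** Every nontrivial subgroup of a cyclic group of order [p ^ e.+1] contains [b *+ p ^ e]. An open
    subgroup [D] avoiding this single nonzero element therefore meets the group generated by [b]
    trivially. *)
Lemma torsion_step (V W : set B) e :
  is_subgroup V -> open V -> is_subgroup W -> open W ->
  exists (b : B) (V' : set B),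
    [/\ is_subgroup V' /\ open V', V' `<=` V `&` W, V b,
        forall z : int, (b *~ z == 0) = (p ^ e.+1 %| `|z|)%N &
        forall z : int, V' (b *~ z) -> b *~ z = 0].
Proof.
move=> sV oV sW oW; have [b [Vb b0 nb0]] := torsion_in_open_subgroup e sV oV.
have b_order z : (b *~ z == 0) = (p ^ e.+1 %| `|z|)%N.
  apply/eqP/idP => [bz|/dvdnP [q qz]].
    exact: (exact_prime_power_order p_prime (subgroup_set0 B) b0 nb0 bz).
  case: z qz => n /= qz; rewrite ?NegzE ?mulrNz -pmulrn ?[n]qz.
    by rewrite mulnC mulrnA b0 mul0rn.
  by rewrite [n.+1]qz mulnC mulrnA b0 mul0rn oppr0.
have [D [sD oD nD]] : exists D : set B, [/\ is_subgroup D, open D & ~ D (b *+ p ^ e)].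
  apply: contrapT => nD; apply: nb0; apply: (profinite_separated B_pro_p.1).
  by move=> D sD oD; apply: contrapT => nDb; apply: nD; exists D.
exists b, (V `&` W `&` D); split => //.
- split; first by do 2! apply: subgroupI => //.
  by do 2! apply: openI => //.
- move=> z [_ Dz]; apply/eqP; rewrite b_order.
  apply: (exact_prime_power_order p_prime sD _ nD Dz).
  by rewrite b0; exact: subgroup0.
Qed.

Lemma torsion_sequence (W : nat -> set B) (e : nat -> nat) :
  (forall n, is_subgroup (W n)) -> (forall n, open (W n)) ->
  exists (b : nat -> B) (V : nat -> set B), forall n,
    [/\ is_subgroup (V n) /\ open (V n), V n.+1 `<=` V n `&` W n, V n (b n),
        forall z : int, (b n *~ z == 0) = (p ^ (e n).+1 %| `|z|)%N &
        forall z : int, V n.+1 (b n *~ z) -> b n *~ z = 0].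
Proof.
move=> sW oW.
(* Bundling openness and the subgroup property into the state lets the step be iterated, starting
   from the whole group. *)
pose state := {V : set B | is_subgroup V /\ open V}.
have /choice [g gP] : forall nV : nat * state, exists bV : B * state,
    [/\ sval bV.2 `<=` sval nV.2 `&` W nV.1, sval nV.2 bV.1,
        forall z : int, (bV.1 *~ z == 0) = (p ^ (e nV.1).+1 %| `|z|)%N &
        forall z : int, sval bV.2 (bV.1 *~ z) -> bV.1 *~ z = 0].
  move=> [n [V [sV oV]]] /=.
  have [b [V' [VP V1 V2 V3 V4]]] := torsion_step (e n) sV oV (sW n) (oW n).
  by exists (b, exist _ V' VP).
have stT : is_subgroup [set: B] /\ open [set: B] by split => //; exact: openT.
pose V := fix V n : state := if n is m.+1 then (g (m, V m)).2 else exist _ _ stT.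
exists (fun n => (g (n, V n)).1), (fun n => sval (V n)) => n.
have [V1 V2 V3 V4] := gP (n, V n).
by split => //; exact: svalP (V n).
Qed.

End torsion_sequence.

(** * Convergence and injectivity of a series of characters *)

Section series_of_characters.
Variables (A B : topologicalZmodType) (V : nat -> set B) (phi : nat -> A -> B).
Hypotheses (cB : compact [set: B]) (hB : hausdorff_space B).
Hypotheses (sV : forall n, is_subgroup (V n)) (oV : forall n, open (V n)).
Hypotheses (Vdec : forall n, V n.+1 `<=` V n).
Hypothesis Vbasis : forall N, nbhs 0 N -> exists n, V n `<=` N.
Hypothesis phiB : forall n x y, phi n (x - y) = phi n x - phi n y.
Hypothesis phiV : forall n x, V n (phi n x).
Hypothesis phiV0 : forall n x, V n.+1 (phi n x) -> phi n x = 0.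
Hypothesis phi_continuous : forall n, nbhs 0 [set x | phi n x = 0].
Hypothesis phi_separates : forall x, (forall n, phi n x = 0) -> x = 0.

Let s n x := \sum_(j < n) phi j x.

Lemma filtration_sub m n : (m <= n)%N -> V n `<=` V m.
Proof.
move=> mn; rewrite -(subnK mn); elim: (n - m)%N => [//|k IH].
by rewrite addSn; apply: subset_trans IH.
Qed.

Lemma filtration_eq x y : (forall n, V n (x - y)) -> x = y.
Proof.
move=> xy; apply/eqP; rewrite -subr_eq0; apply/eqP/esym/hB => N N' N0 N'x.
have [n VN] := Vbasis N0.
by exists (x - y); split; [apply: VN; exact: xy | exact: nbhs_singleton].
Qed.

Lemma partial_sumB n x y : s n (x - y) = s n x - s n y.
Proof. by rewrite /s -sumrB; apply: eq_bigr => j _; exact: phiB. Qed.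

Lemma partial_sum_cauchy m n x : (n <= m)%N -> V n (s m x - s n x).
Proof.
move=> nm; rewrite -(subnKC nm); elim: (m - n)%N => [|k IH].
  by rewrite addn0 subrr; exact: subgroup0.
rewrite addnS {1}/s big_ord_recr /= addrAC; apply: subgroupD => //.
by apply: (@filtration_sub n (n + k)) => //; exact: leq_addr.
Qed.

(** Compactness gives a cluster point [y] of the partial sums. From rank [n] on they stay in one
    coset of [V n], which is closed and so contains [y]. *)
Lemma partial_sum_limit x : exists y, forall n, V n (y - s n x).
Proof.
pose F := (fun n => s n x) @ \oo.
have [y [_ yF]] : [set: B] `&` cluster F !=set0 by apply: cB => //; exact: filterT.
exists y => n.
suff : closure [set z | V n (z - s n x)] y by move/(coset_closed (sV n) (oV n)).
move=> N Ny.
apply: yF => //; exists n => // m /= nm; exact: partial_sum_cauchy.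
Qed.

Lemma character_series_embedding :
  exists f : {additive A -> B}, [/\ continuous (f : A -> B), injective f &
    forall n x, V n (f x - s n x)].
Proof.
have [f fP] := choice partial_sum_limit.
have fB : zmod_morphism f.
  move=> x y; apply: filtration_eq => n.
  have := subgroupB (sV n) (fP (x - y) n) (subgroupB (sV n) (fP x n) (fP y n)).
  have -> : f x - s n x - (f y - s n y) = f x - f y - s n (x - y).
    by rewrite partial_sumB opprD addrACA -opprD.
  by rewrite opprB addrA subrK.
pose fM := GRing.isZmodMorphism.Build A B f fB.
pose fA : {additive A -> B} := HB.pack f fM.
exists fA; split=> [x N /= Nfx||]; last by move=> n x; exact: fP.
- have [n VN] := Vbasis ((nbhs_addl _ _).1 Nfx).
  (* Modulo [V n] the sum is the finite sum [s n], whose terms all vanish near 0; this gives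
     continuity. *)
  have n0 : nbhs 0 [set u | s n u = 0].
    elim: n {VN} => [|n IH]; first by apply: filterE => u; rewrite /s /= big_ord0.
    apply: filterS (filterI IH (phi_continuous n)) => u [/= su pu].
    by rewrite /s big_ord_recr /= -/(s n u) su pu addr0.
  apply/nbhs_addl; apply: filterS n0 => u /= su.
  rewrite -[f (x + u)]/(fA (x + u)) raddfD; apply: VN.
  by have := fP u n; rewrite su subr0.
- move=> x y fxy; apply/eqP; rewrite -subr_eq0; apply/eqP; apply: phi_separates.
  have f0 : f (x - y) = 0 by apply/eqP; rewrite fB subr_eq0; apply/eqP.
  move=> n; elim/ltn_ind: n => n IH; apply: phiV0.
  have := subgroupN (sV n.+1) (fP (x - y) n.+1).
  rewrite f0 sub0r opprK /s big_ord_recr /= big1 ?add0r // => i _.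
  exact: IH.
Qed.

End series_of_characters.

(** * Embeddings of compact groups *)

Lemma range_subgroup (A B : zmodType) (f : {additive A -> B}) : is_subgroup (range f).
Proof.
split; first by exists 0; rewrite ?raddf0.
by move=> _ _ [x _ <-] [y _ <-]; exists (x - y); rewrite ?raddfB.
Qed.

(** A continuous map from a compact space to a Hausdorff one is closed, and the preimage of [C]
    under the inverse is the image of [C] under [f]. *)
Lemma compact_embedding (A B : topologicalZmodType) (f : {additive A -> B}) :
  compact [set: A] -> hausdorff_space B ->
  continuous (f : A -> B) -> injective f ->
  closed (range f) /\ top_isomorphic A B (range f).
Proof.
move=> cA hB cf finj.
have clf (C : set A) : closed C -> closed (f @` C).
  move=> clC; apply: compact_closed hB _; apply: continuous_compact.
    exact: continuous_subspaceT.
  exact: subclosed_compact clC cA _.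
split; first exact: clf closedT.
pose g y := xget 0 [set x | f x = y].
have fK : cancel f g.
  by move=> x; apply: finj; apply: (@xgetPex A 0 [set x' | f x' = f x]); exists x.
exists f, g; split => //; apply/continuous_closedP => C clC.
apply/closed_subspaceP; exists (f @` C); first exact: clf.
apply/seteqP; split=> [_ [[x Cx <-] _]|z [gC [x _ fx]]]; split => /=.
- by rewrite /from_subspace fK.
- by exists x.
- by exists x => //; move: gC; rewrite /= /from_subspace -fx fK.
- by exists x.
Qed.

(** * Construction of the embedding into the closure of the torsion *)

Theorem theorem4p1 (p : nat) (A B : topologicalZmodType)
  (p_prime : prime p)
  (A_pro_p : pro_p p A) (A_countably_based : countably_based A)
  (B_pro_p : pro_p p B) (B_countably_based : countably_based B)
  (tB_unbounded : unbounded_exponent (torsion B)) :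
  exists H : set B,
    closed_subgroup_of (closure (torsion B)) H /\ top_isomorphic A B H.
Proof.
have [[cA hA _] [cB hB _]] := (A_pro_p.1, B_pro_p.1).
have [U [sU oU Ubasis]] := open_subgroup_basis A_pro_p.1 A_countably_based.
have [W [sW oW Wbasis]] := open_subgroup_basis B_pro_p.1 B_countably_based.
have /choice [k Uk] n : exists k, has_index (U n) (p ^ k)%N.
  exact: A_pro_p.2.
have /choice [r rU] n : exists r : nat -> A, forall x, exists i, U n (x - r i).
  have [r [rU _]] := coset_representatives (sU n) (Uk n).
  (* Padding by 0 beyond the index makes the representatives a sequence on all of [nat]. *)
  exists (fun i => if insub i is Some j then r j else 0) => x.
  by have [i Ui] := rU x; exists (val i); rewrite valK.
(* Enumerates the pairs (open subgroup, representative) by a single index; numbers coding no pair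
   give [(0, 0)]. *)
pose c m : nat * nat := odflt (0, 0)%N (unpickle m).
have [b [V bV]] := torsion_sequence p_prime B_pro_p tB_unbounded
  (fun n => k (c n).1) sW oW.
have /choice [phi phiP] n : exists f : A -> B,
    [/\ forall x y, f (x - y) = f x - f y,
        forall u, U (c n).1 u -> f u = 0,
        ~ U (c n).1 (r (c n).1 (c n).2) -> f (r (c n).1 (c n).2) <> 0 &
        forall x, exists z : int, f x = b n *~ z].
  have [Ux|nUx] := pselect (U (c n).1 (r (c n).1 (c n).2)).
    exists (fun=> 0); split => // [x y|x]; first by rewrite subr0.
    by exists 0; rewrite mulr0z.
  have [_ _ _ b_order _] := bV n.
  (* The torsion sequence supplies orders [p ^ (k + 1)], one factor [p] above the index, so that
     they are never trivial. *)
  have Upe x : U (c n).1 (x *+ p ^ (k (c n).1).+1).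
    by rewrite expnSr mulrnA; apply: subgroupMn => //; exact: index_mulrn.
  have [f [f1 f2 f3 f4]] :=
    separating_character p_prime (sU _) Upe b_order (Uk _) nUx.
  by exists f.
have sV n : is_subgroup (V n) by have [[]] := bV n.
have phiV n x : V n (phi n x).
  have [_ _ Vb _ _] := bV n; have [_ _ _ /(_ x) [z ->]] := phiP n.
  exact: subgroupMz.
have [||||||||f [cf finj fV]] := @character_series_embedding A B V phi cB hB sV.
- by move=> n; have [[]] := bV n.
- by move=> n y; have [_ VW _ _ _] := bV n; case/VW.
- move=> N /Wbasis [n WN]; exists n.+1; have [_ VW _ _ _] := bV n.
  by apply: subset_trans WN => y /VW [].
- by move=> n; have [] := phiP n.
- exact: phiV.
- move=> n x; have [_ _ _ _ Vb] := bV n; have [_ _ _ /(_ x) [z ->]] := phiP n.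
  exact: Vb.
- move=> n; have [_ phiU _ _] := phiP n.
  by apply: filterS (open_subgroup_nbhs (sU (c n).1) (oU _)) => x /phiU.
(* If [x] were outside [U n], so would be its representative, and the character numbered by that
   pair takes the same nonzero value at both. *)
- move=> x phix; apply: (profinite_separated A_pro_p.1) => D sD oD.
  have [n UD] := Ubasis _ (open_subgroup_nbhs sD oD); apply: UD.
  have [i Ui] := rU n x.
  have [_ phiU phir _] := phiP (pickle (n, i)).
  have phiB := let: And4 h _ _ _ := phiP (pickle (n, i)) in h.
  rewrite /c pickleK /= in phiU phir.
  apply: contrapT => nUx; apply: phir.
    by move=> Ur; apply: nUx; exact: subgroup_trans Ur.
  by have := phiU _ Ui; rewrite phiB phix sub0r => /eqP; rewrite oppr_eq0 => /eqP.
have [clf isof] := compact_embedding cA hB cf finj.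
exists (range f); split => //; split => //; first exact: range_subgroup.
(* [f x] is a limit of its partial sums, which are torsion as finite sums of multiples of the
   [b j]. *)
move=> _ [x _ <-] N /nbhs_addl Nfx.
have [n WN] := Wbasis _ Nfx.
have VN : V n.+1 `<=` [set y | N (f x + y)].
  by have [_ VW _ _ _] := bV n; apply: subset_trans WN => y /VW [].
exists (\sum_(j < n.+1) phi j x); split; last first.
  rewrite -[\sum_(j < _) _](subrK (f x)) addrC; apply: VN.
  by rewrite -opprB; apply: subgroupN.
(* The factor at [j] is the order of [b j], so the product kills every term. *)
exists (\prod_(j < n.+1) p ^ (k (c j).1).+1)%N.
  by apply: prodn_gt0 => j; rewrite expn_gt0 prime_gt0.
rewrite -sumrMnl big1 // => j _.
have [_ _ _ /(_ x) [z ->]] := phiP j; have [_ _ _ b_order _] := bV j.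
apply/eqP; rewrite pmulrn -mulrzA b_order abszM absz_nat.
by rewrite dvdn_mull // (bigD1 j) //= dvdn_mulr.
Qed.
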